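(* Let $A$ be a ring. Let $B$ be an $A$-algebra. Let $(I_\rho)_{\rho\in\mathbb{N}}$ be an ideal semifiltration of $A$. Let $x\in B$ and $y\in B$. (a) The sequence $\left(I_\rho A[x]\right)_{\rho\in\mathbb{N}}$ is an ideal semifiltration of $A[x]$; the sequence $\left(I_\rho A[y]\right)_{\rho\in\mathbb{N}}$ is an ideal semifiltration of $A[y]$; and the sequence $\left(I_\rho A[xy]\right)_{\rho\in\mathbb{N}}$ is an ideal semifiltration of $A[xy]$. (b) Let $m\in\mathbb{N}$ and $n\in\mathbb{N}$. Let $u\in B$. Assume that $u$ is $n$-integral over $\left(A[x],(I_\rho A[x])_{\rho\in\mathbb{N}}\right)$, and that $u$ is $m$-integral over $\left(A[y],(I_\rho A[y])_{\rho\in\mathbb{N}}\right)$. Then there exists some $\lambda\in\mathbb{N}$ such that $u$ is $\lambda$-integral over $\left(A[xy],(I_\rho A[xy])_{\rho\in\mathbb{N}}\right)$.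
   Context: All rings are commutative with unity, and ''$A$-algebra'' means commutative unital $A$-algebra (the structure map $A\to B$ need not be injective). $\mathbb{N}=\{0,1,2,\ldots\}$. For an $A$-algebra $B$ and $v\in B$, $A[v]=\{P(v)\mid P\in A[X]\}$ is the $A$-subalgebra of $B$ generated by $v$; $B$ is an $A[v]$-algebra since $A[v]$ is a subring of $B$. For an ideal $I$ of $A$, $IA[v]$ means $I\cdot(A[v])$, the ideal of $A[v]$ consisting of finite sums of products $ab$ with $a\in I$, $b\in A[v]$. An ideal semifiltration of a ring $A$ is a sequence $(I_\rho)_{\rho\in\mathbb{N}}$ of ideals of $A$ such that $I_0=A$ and $I_aI_b\subseteq I_{a+b}$ for all $a,b\in\mathbb{N}$. Given an ideal semifiltration $(I_\rho)_{\rho\in\mathbb{N}}$ of a ring $A$ and $n\in\mathbb{N}$, an element $u$ of an $A$-algebra $B$ is called $n$-integral over $(A,(I_\rho)_{\rho\in\mathbb{N}})$ if there exists $(a_0,a_1,\ldots,a_n)\in A^{n+1}$ such that $\sum_{k=0}^{n}a_ku^k=0$, $a_n=1$, and $a_i\in I_{n-i}$ for every $i\in\{0,1,\ldots,n\}$. *)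

(* Defs.v *)
From HB Require Import structures.
From mathcomp Require Import all_boot all_order all_algebra.
From mathcomp Require Import boolp classical_sets.
Set Implicit Arguments.
Unset Strict Implicit.
Unset Printing Implicit Defensive.
Import GRing.Theory.
Local Open Scope classical_set_scope.
Local Open Scope ring_scope.

(* An A-algebra B is given by its structure map f : {rmorphism A -> B} between
   [comPzRingType]s, as in [integralOver]; unlike [comAlgType], this allows the
   zero ring. *)

(* [idealr] is boolean and excludes the unit ideal, hence this definition. *)
Definition is_ideal (R : comPzRingType) (I : set R) : Prop :=
  [/\ I 0,
      forall x y, I x -> I y -> I (x + y)
    & forall a x, I x -> I (a * x)].

Definition ideal_mul (R : comPzRingType) (I J : set R) : set R :=
  [set z | exists n (x y : 'I_n -> R),
     [/\ forall i, I (x i), forall i, J (y i) & z = \sum_(i < n) x i * y i]].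

Definition ideal_semifiltration (R : comPzRingType) (I : nat -> set R) : Prop :=
  [/\ forall r, is_ideal (I r),
      I 0%N = setT
    & forall a b, ideal_mul (I a) (I b) `<=` I (a + b)%N].

Definition ideal_ext (A C : comPzRingType) (f : {rmorphism A -> C})
    (I : set A) : set C :=
  [set z | exists n (a : 'I_n -> A) (c : 'I_n -> C),
     (forall i, I (a i)) /\ z = \sum_(i < n) f (a i) * c i].

Definition n_integral (A B : comPzRingType) (f : {rmorphism A -> B})
    (I : nat -> set A) (n : nat) (u : B) : Prop :=
  exists a : 'I_n.+1 -> A,
    [/\ \sum_(k < n.+1) f (a k) * u ^+ k = 0,
        a ord_max = 1
      & forall i : 'I_n.+1, I (n - i)%N (a i)].

Section Adjoin.
Variables (A B : comPzRingType) (f : {rmorphism A -> B}) (v : B).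

(* The polynomial P is represented by its list of coefficients p, since
   [{poly A}] would require A to be nonzero. *)
Definition eval_coefs (p : seq A) : B := \sum_(i < size p) f p`_i * v ^+ i.

Definition adjoin_pred : {pred B} :=
  fun b => `[< exists p : seq A, b = eval_coefs p >].

Record adjoin := Adjoin {adjoin_val : B; _ : adjoin_val \in adjoin_pred}.

Lemma eval_coefs_nil : eval_coefs [::] = 0.
Proof. by rewrite /eval_coefs big_ord0. Qed.

Lemma eval_coefs_cons a p : eval_coefs (a :: p) = f a + eval_coefs p * v.
Proof.
rewrite /eval_coefs big_ord_recl expr0 mulr1; congr (_ + _).
by rewrite mulr_suml; apply: eq_bigr => i _; rewrite exprSr mulrA.
Qed.

Lemma adjoinP b : reflect (exists p, b = eval_coefs p) (b \in adjoin_pred).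
Proof. exact: asboolP. Qed.

Lemma adjoin_struct_subproof a : f a \in adjoin_pred.
Proof.
by apply/adjoinP; exists [:: a]; rewrite eval_coefs_cons eval_coefs_nil mul0r addr0.
Qed.

Lemma adjoin_predD b c :
  b \in adjoin_pred -> c \in adjoin_pred -> b + c \in adjoin_pred.
Proof.
move=> /adjoinP[p ->] /adjoinP[q ->]; apply/adjoinP.
elim: p q => [|a p IHp] [|a' q].
- by exists [::]; rewrite eval_coefs_nil addr0.
- by exists (a' :: q); rewrite eval_coefs_nil add0r.
- by exists (a :: p); rewrite eval_coefs_nil addr0.
have [r Er] := IHp q; exists (a + a' :: r).
by rewrite !eval_coefs_cons rmorphD -Er mulrDl addrACA.
Qed.

Lemma adjoin_predZ a b : b \in adjoin_pred -> f a * b \in adjoin_pred.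
Proof.
move=> /adjoinP[p ->]; apply/adjoinP; exists [seq a * x | x <- p].
elim: p => [|x p IHp] /=; first by rewrite eval_coefs_nil mulr0.
by rewrite !eval_coefs_cons -IHp mulrDr rmorphM mulrA.
Qed.

Lemma adjoin_predM b c :
  b \in adjoin_pred -> c \in adjoin_pred -> b * c \in adjoin_pred.
Proof.
move=> /adjoinP[p ->] hc; elim: p => [|a p IHp].
  by rewrite eval_coefs_nil mul0r -(rmorph0 f) adjoin_struct_subproof.
rewrite eval_coefs_cons mulrDl; apply: adjoin_predD; first exact: adjoin_predZ.
rewrite mulrAC; case/adjoinP: IHp => q ->; apply/adjoinP; exists (0 :: q).
by rewrite eval_coefs_cons rmorph0 add0r.
Qed.

Lemma adjoin_subring_closed : subring_closed adjoin_pred.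
Proof.
split=> [|b c hb hc|]; last exact: adjoin_predM.
  by rewrite -(rmorph1 f) adjoin_struct_subproof.
apply: adjoin_predD => //.
by rewrite -mulN1r -(rmorph1 f) -rmorphN adjoin_predZ.
Qed.

HB.instance Definition _ :=
  GRing.isSubringClosed.Build B adjoin_pred adjoin_subring_closed.
HB.instance Definition _ := [isSub for adjoin_val].
HB.instance Definition _ := [Choice of adjoin by <:].
HB.instance Definition _ := GRing.SubChoice_isSubComPzRing.Build B adjoin_pred adjoin adjoin_subring_closed.

HB.instance Definition _ :=
  GRing.RMorphism.copy adjoin_val (val : adjoin -> B).

Definition adjoin_struct (a : A) : adjoin :=
  Adjoin (adjoin_struct_subproof a).

Lemma adjoin_struct_zmod_morphism : zmod_morphism adjoin_struct.
Proof. by move=> a b; apply: val_inj; rewrite /= rmorphB. Qed.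

Lemma adjoin_struct_monoid_morphism : monoid_morphism adjoin_struct.
Proof.
by split=> [|a b]; apply: val_inj; rewrite /= ?rmorph1 ?rmorphM.
Qed.

HB.instance Definition _ :=
  GRing.isZmodMorphism.Build A adjoin adjoin_struct adjoin_struct_zmod_morphism.
HB.instance Definition _ :=
  GRing.isMonoidMorphism.Build A adjoin adjoin_struct
    adjoin_struct_monoid_morphism.

End Adjoin.

Arguments adjoin_val {A B} f v _.

Definition adjoin_semifilt (A B : comPzRingType) (f : {rmorphism A -> B})
    (I : nat -> set A) (v : B) : nat -> set (adjoin f v) :=
  fun r => ideal_ext (adjoin_struct f v) (I r).

Arguments adjoin_semifilt {A B} f I v _ _.

(* Main.v *)
Require Import Defs.
From HB Require Import structures.
From mathcomp Require Import all_boot all_order all_algebra perm ring.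
From mathcomp Require Import boolp classical_sets.
Set Implicit Arguments.
Unset Strict Implicit.
Unset Printing Implicit Defensive.
Import GRing.Theory.
Local Open Scope classical_set_scope.
Local Open Scope ring_scope.

(** Why the theorem holds. Write z = xy. The hypotheses on u give two relations
    that express u^n and u^m by lower powers of u:
      u^n = sum of terms a x^j u^k,  k < n, j <= P, a in I_(n-k),
      u^m = sum of terms b y^j u^k,  k < m, j <= Q, b in I_(m-k).
    After multiplication by powers of u, both have the same degree N. Consider
    the powers x^i for i <= P + Q. If i < Q, the first relation times x^i
    expresses u^N x^i by terms a x^(i+j) u^k, where i + j <= P + Q. If i >= Q,
    the second relation times x^i expresses it by terms b z^j x^(i-j) u^k,
    because y^j x^i = z^j x^(i-j) for j <= Q <= i. So in both cases
      u^N x^i = sum over j of l_ij x^j   ([power_system]),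
    where each l_ij is a sum of terms c u^k with k < N and c in I_(N-k) A[z].

    Since 1 = x^0 is among the powers, Cramer's rule gives
    det (u^N Id - l) = 0 ([integral_of_system]). It remains to read this as an
    equation for u with coefficients in the right ideals. Give u weight 1 and
    the elements of I_r A[z] weight r. Then u^N and all the l_ij are homogeneous
    of weight N, so a determinant of size d is homogeneous of weight d N; and
    l_ij only contains powers of u below the top one, so modulo lower powers of
    u the determinant is u^(dN). The predicate [weighted] expresses this
    bookkeeping with elements of B rather than with polynomials, and
    [weighted_det] is the congruence between determinants.

    The semifiltration claims hold for the extension of ideals along any ring
    morphism, since (I_a C)(I_b C) = (I_a I_b) C ([ideal_ext_semifiltration]). *)

(** * Additive spans *)

(** Ideals I C, products of ideals, and the expressions in powers of u and x
    below are all sets of finite sums. The inductive form lets one prove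
    facts on them by induction, with the terms of the sum left unindexed. *)
Inductive addspan (V : nmodType) (M : set V) : V -> Prop :=
| addspan0 : addspan M 0
| addspan_cons m b : M m -> addspan M b -> addspan M (m + b).

Lemma addspan1 (V : nmodType) (M : set V) m : M m -> addspan M m.
Proof. by move=> Mm; rewrite -[m]addr0; apply: addspan_cons Mm (addspan0 _). Qed.

Lemma addspanD (V : nmodType) (M : set V) a b :
  addspan M a -> addspan M b -> addspan M (a + b).
Proof.
move=> Ha Hb; elim: Ha => [|m c Mm _ IH]; first by rewrite add0r.
by rewrite -addrA; apply: addspan_cons.
Qed.

Lemma addspan_sum (V : nmodType) (M : set V) n (F : 'I_n -> V) :
  (forall i, addspan M (F i)) -> addspan M (\sum_(i < n) F i).
Proof.
by move=> HF; apply: big_ind => //; [apply: addspan0 | apply: addspanD].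
Qed.

Lemma addspan_subset (V : nmodType) (M M' : set V) b :
  M `<=` addspan M' -> addspan M b -> addspan M' b.
Proof.
move=> sMM'; elim=> [|m c Mm _ IH]; first exact: addspan0.
by apply: addspanD => //; apply: sMM'.
Qed.

Lemma addspan_mull (R : pzRingType) (M M' : set R) c b :
  (forall m, M m -> addspan M' (c * m)) -> addspan M b -> addspan M' (c * b).
Proof.
move=> HM; elim=> [|m d Mm _ IH]; first by rewrite mulr0; apply: addspan0.
by rewrite mulrDr; apply: addspanD => //; apply: HM.
Qed.

Lemma addspan_mul (R : pzRingType) (M M' M'' : set R) a b :
  (forall a b, M a -> M' b -> addspan M'' (a * b)) ->
  addspan M a -> addspan M' b -> addspan M'' (a * b).
Proof.
move=> HM Ha Hb; elim: Ha => [|m d Mm _ IH].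
  by rewrite mul0r; apply: addspan0.
rewrite mulrDl; apply: addspanD => //.
by apply: addspan_mull Hb => m' Mm'; apply: HM.
Qed.

(** * Extension of ideal semifiltrations *)

Lemma ideal_opp (R : comPzRingType) (J : set R) a :
  is_ideal J -> J a -> J (- a).
Proof. by case=> _ _ JM Ja; rewrite -mulN1r; apply: JM. Qed.

Lemma semifiltrationM (R : comPzRingType) (J : nat -> set R) a b p q :
  ideal_semifiltration J -> J a p -> J b q -> J (a + b)%N (p * q).
Proof.
case=> _ _ JM Jp Jq; apply: JM; exists 1%N, (fun=> p), (fun=> q).
by split=> //; rewrite big_ord1.
Qed.

Lemma ideal_extE (A C : comPzRingType) (f : {rmorphism A -> C}) (J : set A) z :
  ideal_ext f J z <->
  addspan [set b | exists a c, J a /\ b = f a * c] z.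
Proof.
split=> [[n [a [c [Ja ->]]]]|].
  by apply: addspan_sum => i; apply: addspan1; exists (a i), (c i).
elim=> [|_ b [a [c [Ja ->]]] _ [n [a' [c' [Ja' ->]]]]].
  exists 0%N, (fun=> 0), (fun=> 0); split; last by rewrite big_ord0.
  by case.
exists n.+1, (fun i => oapp a' a (unlift ord0 i)),
  (fun i => oapp c' c (unlift ord0 i)); split=> [i|].
  by case: (unlift ord0 i).
rewrite big_ord_recl unlift_none /=; congr (_ + _).
by apply: eq_bigr => i _; rewrite liftK.
Qed.

Lemma ideal_ext_semifiltration (A C : comPzRingType) (f : {rmorphism A -> C})
    (I : nat -> set A) :
  ideal_semifiltration I -> ideal_semifiltration (fun r => ideal_ext f (I r)).
Proof.
move=> hI; have [_ I0 _] := hI; split=> [r||a b z].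
- split=> [|u v /ideal_extE Hu /ideal_extE Hv|c u /ideal_extE Hu];
    apply/ideal_extE.
  + exact: addspan0.
  + exact: addspanD.
  apply: addspan_mull Hu => _ [a [d [Ia ->]]]; apply: addspan1.
  by exists a, (c * d); rewrite mulrCA.
- apply/seteqP; split=> // c _; apply/ideal_extE; apply: addspan1.
  by exists 1, c; rewrite I0 rmorph1 mul1r.
move=> [n [u [v [Hu Hv ->]]]]; apply/ideal_extE; apply: addspan_sum => i.
have /ideal_extE := Hu i; have /ideal_extE := Hv i => {}Hv {}Hu.
apply: addspan_mul Hu Hv => _ _ [p [c [Ip ->]]] [q [d [Iq ->]]].
apply: addspan1; exists (p * q), (c * d); split; last by rewrite rmorphM mulrACA.
exact: semifiltrationM.
Qed.

(** * Weighted expressions and the determinant trick *)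

Section Weighted.
Variables (C B : comPzRingType) (g : {rmorphism C -> B}) (J : nat -> set C).
Hypothesis hJ : ideal_semifiltration J.
Variable u : B.

(** The values at u of the polynomials of degree at most D - s that are
    homogeneous of weight D, where u has weight 1 and J_r has weight r.
    Only the gap s between weight and degree matters: it adds up in products. *)
Definition weighted (s D : nat) : B -> Prop :=
  addspan [set b | exists k c,
    [/\ (k + s <= D)%N, J (D - k)%N c & b = g c * u ^+ k]].

Lemma weighted_gap_le s s' D b :
  (s' <= s)%N -> weighted s D b -> weighted s' D b.
Proof.
move=> le_s; apply: addspan_subset => _ [k [c [Hk Jc ->]]]; apply: addspan1.
by exists k, c; split=> //; apply: leq_trans Hk; rewrite leq_add2l.
Qed.

Lemma weightedM s s' D D' a b :
  weighted s D a -> weighted s' D' b -> weighted (s + s') (D + D') (a * b).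
Proof.
apply: addspan_mul => _ _ [k [c [Hk Jc ->]]] [k' [c' [Hk' Jc' ->]]].
apply: addspan1; exists (k + k')%N, (c * c'); split.
- by rewrite addnACA leq_add.
- have -> : (D + D' - (k + k') = (D - k) + (D' - k'))%N.
    have lek := leq_trans (leq_addr _ _) Hk.
    have lek' := leq_trans (leq_addr _ _) Hk'.
    by rewrite subnDA -addnBAC // addnBA.
  exact: semifiltrationM.
by rewrite rmorphM exprD mulrACA.
Qed.

Lemma weightedN s D a : weighted s D a -> weighted s D (- a).
Proof.
move=> Ha; rewrite -mulN1r.
apply: addspan_mull Ha => _ [k [c [Hk Jc ->]]]; apply: addspan1.
exists k, (- c); split=> //; first by apply: ideal_opp => //; case: hJ.
by rewrite mulN1r rmorphN mulNr.
Qed.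

Lemma weighted_pow D : weighted 0 D (u ^+ D).
Proof.
apply: addspan1; exists D, 1; split; first by rewrite addn0.
  by rewrite subnn; case: hJ => _ -> _.
by rewrite rmorph1 mul1r.
Qed.

(** Congruence modulo lower powers of u passes to products; for homogeneity of
    the error term the factors themselves must be homogeneous. *)
Lemma weighted_prod N d (F G : 'I_d -> B) :
  (forall i, weighted 0 N (F i)) -> (forall i, weighted 0 N (G i)) ->
  (forall i, weighted 1 N (F i - G i)) ->
  weighted 0 (d * N) (\prod_i F i) /\
  weighted 1 (d * N) (\prod_i F i - \prod_i G i).
Proof.
elim: d F G => [|d IH] F G HF HG HFG.
  rewrite !big_ord0 mul0n subrr; split; last exact: addspan0.
  by rewrite -(expr0 u); apply: weighted_pow.
have [HPF HPFG] := IH (F \o lift ord0) (G \o lift ord0)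
  (fun=> HF _) (fun=> HG _) (fun=> HFG _).
rewrite !big_ord_recl mulSn; split; first exact: (weightedM (HF _) HPF).
rewrite -(subrKA (G ord0 * \prod_(i < d) F (lift ord0 i))) -mulrBl -mulrBr.
apply: addspanD; first exact: (weightedM (HFG _) HPF).
exact: (weightedM (HG _) HPFG).
Qed.

Lemma weighted_det N d (F G : 'M[B]_d) :
  (forall i j, weighted 0 N (F i j)) -> (forall i j, weighted 0 N (G i j)) ->
  (forall i j, weighted 1 N (F i j - G i j)) ->
  weighted 1 (d * N) (\det F - \det G).
Proof.
move=> HF HG HFG; rewrite /determinant -sumrB.
apply: big_ind; [exact: addspan0 | exact: addspanD | move=> s _].
rewrite -mulrBr; have [_ H] := weighted_prod
  (fun i => HF i (s i)) (fun i => HG i (s i)) (fun i => HFG i (s i)).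
by case: (odd_perm s); rewrite ?mul1r ?mulN1r //; apply: weightedN.
Qed.

(** Collecting terms by powers of u turns a weighted expression of u^D by lower
    powers into the coefficients of an equation. *)
Lemma weighted_coefs D b : weighted 1 D b ->
  exists2 c : nat -> C, forall k, J (D - k)%N (c k)
    & b = \sum_(k < D) g (c k) * u ^+ k.
Proof.
have [Jid _ _] := hJ.
elim=> [|_ b' [k [c [Hk Jc ->]]] _ [e Je ->]].
  exists (fun=> 0) => [k|]; first by case: (Jid (D - k)%N).
  by rewrite big1 // => k _; rewrite rmorph0 mul0r.
rewrite addn1 in Hk.
exists (fun i => (if i == k then c else 0) + e i) => [i|].
  case: (Jid (D - i)%N) => J0 JD _; apply: JD => //.
  by case: eqP => [->|_].
under [RHS]eq_bigr do rewrite rmorphD mulrDl.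
rewrite big_split /=; congr (_ + _).
rewrite (bigD1 (Ordinal Hk)) //= eqxx big1 ?addr0 // => i.
by rewrite -val_eqE /= => /negPf ->; rewrite rmorph0 mul0r.
Qed.

Lemma weighted_integral D : weighted 1 D (u ^+ D) -> n_integral g J D u.
Proof.
move=> /weighted_coefs[c Jc Ec]; have [Jid JT _] := hJ.
exists (fun i : 'I_D.+1 => if i == ord_max then 1 else - c i); split.
- rewrite big_ord_recr /= eqxx rmorph1 mul1r Ec.
  rewrite -big_split big1 //= => i _.
  rewrite -val_eqE /= ltn_eqF ?ltn_ord //.
  by rewrite rmorphN mulNr addNr.
- by rewrite eqxx.
move=> i; case: eqP => [->|_]; first by rewrite /= subnn JT.
by apply: ideal_opp.
Qed.

(** The determinant trick. By Cramer's rule det (u^N Id - l) kills every w_j,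
    hence also 1; and it is congruent to det (u^N Id) = u^(dN) modulo lower
    powers of u. *)
Lemma integral_of_system N d (w : 'I_d -> B) (l : 'I_d -> 'I_d -> B) i0 :
  w i0 = 1 -> (forall i j, weighted 1 N (l i j)) ->
  (forall i, u ^+ N * w i = \sum_j l i j * w j) ->
  n_integral g J (d * N) u.
Proof.
move=> w1 Hl Ew; apply: weighted_integral.
pose S : 'M[B]_d := (u ^+ N)%:M; pose L : 'M[B]_d := \matrix_(i, j) l i j.
pose W : 'cV[B]_d := \col_j w j.
have SLW : (S - L) *m W = 0.
  rewrite mulmxBl mul_scalar_mx; apply/colP => i.
  by rewrite !mxE Ew; apply/eqP; rewrite subr_eq0; apply/eqP/eq_bigr => j _;
    rewrite !mxE.
have det0 : \det (S - L) = 0.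
  have := congr1 (mulmx (\adj (S - L))) SLW.
  rewrite mulmxA mul_adj_mx mulmx0 mul_scalar_mx => /colP /(_ i0).
  by rewrite !mxE w1 mulr1.
have HS i j : weighted 0 N (S i j).
  rewrite mxE; case: eqP => _; [exact: weighted_pow | exact: addspan0].
have HL i j : weighted 1 N ((S - L) i j - S i j).
  rewrite [(S - L) i j]mxE addrAC subrr add0r !mxE.
  exact: weightedN.
have HSL i j : weighted 0 N ((S - L) i j).
  rewrite -[_ i j](subrK (S i j)); apply: addspanD; last exact: HS.
  exact: weighted_gap_le (HL i j).
have := weighted_det HSL HS HL.
by rewrite det0 sub0r det_scalar -exprM mulnC => /weightedN; rewrite opprK.
Qed.

Lemma system_coefs N d (w : 'I_d -> B) b :
  addspan [set e | exists a j, weighted 1 N a /\ e = a * w j] b ->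
  exists2 l : 'I_d -> B, forall j, weighted 1 N (l j)
    & b = \sum_j l j * w j.
Proof.
elim=> [|_ b' [a [j [Ha ->]]] _ [l Hl ->]].
  exists (fun=> 0) => [j|]; first exact: addspan0.
  by rewrite big1 // => j _; rewrite mul0r.
exists (fun i => (if i == j then a else 0) + l i) => [i|].
  apply: addspanD; last exact: Hl.
  by case: (i == j) => //; apply: addspan0.
under [RHS]eq_bigr do rewrite mulrDl.
rewrite big_split /=; congr (_ + _).
by rewrite (bigD1 j) //= eqxx big1 ?addr0 // => i /negPf ->; rewrite mul0r.
Qed.

End Weighted.

(** * Integrality over an adjunction as a relation with bounded exponents *)

Section Relations.
Variables (A B : comPzRingType) (f : {rmorphism A -> B}) (I : nat -> set A).
Hypothesis hI : ideal_semifiltration I.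

(** The terms f a * v^j * u^k allowed in a relation for u^n over A[v]; the
    bound P on the exponents of v is what makes the family of powers of x in
    the main argument finite. *)
Definition relation_terms (v u : B) (n P : nat) : set B :=
  [set b | exists k j a, [/\ (k < n)%N, (j <= P)%N, I (n - k)%N a
                           & b = f a * v ^+ j * u ^+ k]].

Lemma relation_bound_le v u n P P' b : (P <= P')%N ->
  addspan (relation_terms v u n P) b -> addspan (relation_terms v u n P') b.
Proof.
move=> leP; apply: addspan_subset => _ [k [j [a [Hk Hj Ia ->]]]].
by apply: addspan1; exists k, j, a; split=> //; apply: leq_trans leP.
Qed.

Lemma relation_sum v u n d (F : 'I_d -> B) :
  (forall i, exists P, addspan (relation_terms v u n P) (F i)) ->
  exists P, addspan (relation_terms v u n P) (\sum_i F i).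
Proof.
move=> HF; apply: (big_ind (fun b => exists P, addspan _ b)) => //.
  by exists 0%N; apply: addspan0.
move=> b c [P HP] [P' HP']; exists (maxn P P').
by apply: addspanD; [apply: relation_bound_le HP | apply: relation_bound_le HP'];
  rewrite ?leq_maxl ?leq_maxr.
Qed.

Lemma relation_of_coef v u n k (a : adjoin f v) : (k < n)%N ->
  adjoin_semifilt f I v (n - k)%N a ->
  exists P, addspan (relation_terms v u n P) (adjoin_val f v a * u ^+ k).
Proof.
move=> ltkn [d [c [e [Ic ->]]]].
rewrite rmorph_sum mulr_suml; apply: relation_sum => i.
case: (e i) => b Hb; have /adjoinP[p Ep] := Hb.
rewrite rmorphM /= Ep /eval_coefs mulr_sumr mulr_suml.
apply: relation_sum => j; exists j; apply: addspan1.
exists k, j, (p`_j * c i); split=> //; last by rewrite mulrA rmorphM [f _ * _]mulrC.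
by case: hI => /(_ (n - k)%N)[_ _ IM] _ _; apply: IM.
Qed.

Lemma relation_of_integral v u n :
  n_integral (adjoin_val f v) (adjoin_semifilt f I v) n u ->
  exists P, addspan (relation_terms v u n P) (u ^+ n).
Proof.
move=> [a [Ea a1 Ia]].
have [Jid _ _] := ideal_ext_semifiltration (adjoin_struct f v) hI.
move: Ea; rewrite big_ord_recr /= a1 rmorph1 mul1r addrC.
move=> /eqP; rewrite addr_eq0 -sumrN => /eqP ->.
apply: relation_sum => k; rewrite -mulNr -rmorphN.
apply: relation_of_coef; first exact: ltn_ord.
by apply: ideal_opp (Jid _) _; apply: (Ia (widen_ord (leqnSn n) k)).
Qed.

(** Multiplying a relation by a power of u preserves the ideals of its
    coefficients, because they depend only on the codegree n - k. *)
Lemma relation_degree_le v u n N P : (n <= N)%N ->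
  addspan (relation_terms v u n P) (u ^+ n) ->
  addspan (relation_terms v u N P) (u ^+ N).
Proof.
move=> leN; rewrite -{2}(subnK leN) exprD.
apply: addspan_mull => _ [k [j [a [Hk Hj Ia ->]]]]; apply: addspan1.
exists (N - n + k)%N, j, a; split=> //.
- by rewrite -{2}(subnK leN) ltn_add2l.
- by rewrite subnDA subKn.
by rewrite mulrCA -exprD.
Qed.

(** * The powers of x as a module over A[xy] *)

Lemma adjoin_gen_pow z j : z ^+ j \in adjoin_pred f z.
Proof.
apply/adjoinP; elim: j => [|j [p Ep]].
  by exists [:: 1]; rewrite eval_coefs_cons eval_coefs_nil rmorph1 mul0r addr0.
by exists (0 :: p); rewrite eval_coefs_cons rmorph0 add0r -Ep exprSr.
Qed.

Lemma weighted_term z u N k j a : (k < N)%N -> I (N - k)%N a ->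
  weighted (adjoin_val f z) (adjoin_semifilt f I z) u 1 N
    (f a * z ^+ j * u ^+ k).
Proof.
move=> Hk Ia; apply: addspan1.
exists k, (adjoin_struct f z a * Adjoin (adjoin_gen_pow z j)).
split; [by rewrite addn1 | | by rewrite rmorphM].
by apply/ideal_extE; apply: addspan1; exists a, (Adjoin (adjoin_gen_pow z j)).
Qed.

(** The case split at i = Q is the heart of the proof: below Q there is room to
    raise the exponent of x by the first relation, and from Q on there are
    enough factors x to turn each y^j of the second relation into (xy)^j. *)
Lemma power_system x y u N P Q (i : 'I_(P + Q).+1) :
  addspan (relation_terms x u N P) (u ^+ N) ->
  addspan (relation_terms y u N Q) (u ^+ N) ->
  addspan [set e | exists a (j : 'I_(P + Q).+1),
      weighted (adjoin_val f (x * y)) (adjoin_semifilt f I (x * y)) u 1 N a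
      /\ e = a * x ^+ j] (x ^+ i * u ^+ N).
Proof.
move=> Hx Hy; have [ltiQ|leQi] := ltnP i Q.
  apply: addspan_mull Hx => _ [k [j [a [Hk Hj Ia ->]]]]; apply: addspan1.
  have Hij : (i + j < (P + Q).+1)%N by rewrite ltnS addnC leq_add // ltnW.
  exists (f a * (x * y) ^+ 0 * u ^+ k), (Ordinal Hij).
  split; first exact: weighted_term.
  by rewrite /= exprD; ring.
apply: addspan_mull Hy => _ [k [j [a [Hk Hj Ia ->]]]]; apply: addspan1.
have Hji : (j <= i)%N by apply: leq_trans leQi.
have Hij : (i - j < (P + Q).+1)%N by apply: leq_ltn_trans (leq_subr _ _) _.
exists (f a * (x * y) ^+ j * u ^+ k), (Ordinal Hij).
split; first exact: weighted_term.
rewrite /= -{1}(subnKC Hji) exprD exprMn.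
set p := x ^+ j; set q := y ^+ j; ring.
Qed.

End Relations.

Theorem theorem5p6 (A B : comPzRingType) (f : {rmorphism A -> B})
    (I : nat -> set A) (hI : ideal_semifiltration I) (x y : B) :
  [/\ ideal_semifiltration (adjoin_semifilt f I x),
      ideal_semifiltration (adjoin_semifilt f I y)
    & ideal_semifiltration (adjoin_semifilt f I (x * y))]
  /\
  (forall (m n : nat) (u : B),
     n_integral (adjoin_val f x) (adjoin_semifilt f I x) n u ->
     n_integral (adjoin_val f y) (adjoin_semifilt f I y) m u ->
     exists l : nat,
       n_integral (adjoin_val f (x * y)) (adjoin_semifilt f I (x * y)) l u).
Proof.
split=> [|m n u]; first by split; apply: ideal_ext_semifiltration.
move=> /(relation_of_integral hI)[P Hx] /(relation_of_integral hI)[Q Hy].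
pose N := maxn n m; exists ((P + Q).+1 * N)%N.
have {}Hx := relation_degree_le (leq_maxl n m) Hx.
have {}Hy := relation_degree_le (leq_maxr n m) Hy.
pose w (i : 'I_(P + Q).+1) := x ^+ i.
have /all_sig2[l Hl Ew] :=
  fun i => cid2 (system_coefs (w := w) (power_system i Hx Hy)).
apply: (integral_of_system (w := w) (i0 := ord0) _ _ Hl) => //.
- exact: ideal_ext_semifiltration.
by move=> i; rewrite mulrC Ew.
Qed.
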